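(* Suppose $L\ge2$. Given a point $(\hat x,\hat y,\hat u)\in\mathbb{R}_+^{3T-1}$, there exists an $\mathcal{O}(T^3)$ time separation algorithm that finds the most violated inequality at $(\hat x,\hat y,\hat u)$, if any is violated, among the family of inequalities \begin{align*} x_{t-2}-x_{t-1}+x_t\le{}&\overline{V}y_{t-2}-(\overline{V}-V)y_{t-1}+\overline{V}y_t+V\sum_{i\in S}(i-d_i)\Bigl(y_i-\sum_{j=0}^{L-1}u_{i-j}\Bigr)-\phi(u,t)\\ &+\alpha(S,t)\,V\Bigl(y_t-\sum_{k=0}^{L-1}u_{t-k}\Bigr)+\sum_{k=3}^{L-1}(k-2)V\,u_{t-k}+\beta(t)\Bigl(y_{t-m}-\sum_{j=0}^{L-1}u_{t-m-j}\Bigr) \end{align*} indexed by all $(t,m,S)$ with $t\in[L+1,T]_{\mathbb{Z}}$, $m$ an integer with $[3-L]^+\le m\le\min\{[t-L-1]^+,[(\overline{C}-\overline{V})/V-L+3]^+\}$, and $S\subseteq[t-m+1,t-1]_{\mathbb{Z}}$ if $L\ge3$, $S\subseteq[t-m+1,t-2]_{\mathbb{Z}}$ if $L=2$. Here $d_i=\max\{a\in S\cup\{t-m\}:a<i\}$ for $i\in S$, $\phi(u,t)=[\underline{C}+V-\overline{V}]^+u_{t-2}$ if $L=2$ and $\phi(u,t)=0$ otherwise, $\alpha(S,t)=[m+L-3]^+-\sum_{i\in S}(i-d_i)$, and $\beta(t)=\overline{C}-\overline{V}-[m+L-3]^+V$.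
   Context: $T$ (number of time periods) and $L$ (minimum-up time) are positive integers with $T\ge L+1$, and $\underline{C},\overline{C},\overline{V},V$ are real parameters (generation lower bound, generation upper bound, start-up/shut-down ramp rate, ramp rate) with $0\le\underline{C}\le\overline{V}\le\overline{C}$ and $V>0$. Vectors are $x=(x_1,\dots,x_T)$, $y=(y_1,\dots,y_T)$, $u=(u_2,\dots,u_T)$, so $(x,y,u)\in\mathbb{R}^{3T-1}$. For integers $a,b$, $[a,b]_{\mathbb{Z}}$ is the set of integers $i$ with $a\le i\le b$; $[a]^+=\max\{a,0\}$; empty sums are $0$. The violation of an inequality at a point is its left-hand side minus its right-hand side evaluated at the point; an inequality is violated if this is positive, and most violated means maximum violation over the family. In the running time bound, the number $[(\overline{C}-\overline{V})/V-L+3]^+$ (bounding $m$) is regarded as a constant, and the asymptotics are in $T$. *)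

(* Defs.v *)
From HB Require Import structures.
From mathcomp Require Import all_boot all_order all_algebra.
From mathcomp Require Import reals.
Set Implicit Arguments.
Unset Strict Implicit.
Unset Printing Implicit Defensive.
Import Order.TTheory GRing.Theory Num.Theory.
Local Open Scope ring_scope.

(** * The family of inequalities *)

(* T time periods, minimum-up time L, generation bounds Clow <= Cup, start-up
   and shut-down ramp rate Vbar, ramp rate V, and the point (x, y, u) to be
   separated. *)
Record instance (R : realType) := Instance {
  T : nat;
  L : nat;
  Clow : R;
  Cup : R;
  Vbar : R;
  V : R;
  xhat : 'rV[R]_T;
  yhat : 'rV[R]_T;
  uhat : 'rV[R]_(T.-1) }.

(* The entry with index i of the vector (v_a, ..., v_(a+n-1)); it is 0 when i
   is not an index of the vector. *)
Definition entry (R : realType) (a n : nat) (v : 'rV[R]_n) (i : nat) : R :=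
  if [pick k : 'I_n | (a + k)%N == i] is Some k then v 0 k else 0.

Definition x (R : realType) (I : instance R) : nat -> R := entry 1 (xhat I).
Definition y (R : realType) (I : instance R) : nat -> R := entry 1 (yhat I).
Definition u (R : realType) (I : instance R) : nat -> R := entry 2 (uhat I).

Definition posp (R : realType) (a : R) : R := Num.max a 0.

Definition mcap (R : realType) (I : instance R) : R :=
  posp ((Cup I - Vbar I) / V I - (L I)%:R + 3).

(* A set of periods; the period i is the ordinal with value i. *)
Definition periods (R : realType) (I : instance R) := {set 'I_(T I).+1}.

(* Truncated subtraction of naturals computes [3 - L]^+ and [t - L - 1]^+
   here, and [m + L - 3]^+ below. The bounds on t and m make every other
   subtraction of indices below exact, and every index of x, y, u valid. *)
Definition in_family (R : realType) (I : instance R)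
    (t m : nat) (S : periods I) : Prop :=
  [/\ (L I + 1 <= t <= T I)%N,
      (3 - L I <= m <= t - L I - 1)%N,
      m%:R <= mcap I
    & forall i : 'I_(T I).+1, i \in S ->
        (t - m + 1 <= i <= if 3 <= L I then t - 1 else t - 2)%N].

(* max {a in S \cup {t - m} : a < i} *)
Definition dpred (R : realType) (I : instance R) (t m : nat) (S : periods I)
    (i : nat) : nat :=
  (\max_(a : 'I_(T I).+1 |
           ((a \in S) || (a == t - m :> nat)) && (a < i)) a)%N.

(* sum_(i in S) (i - d_i) w_i *)
Definition gapsum (R : realType) (I : instance R) (t m : nat) (S : periods I)
    (w : nat -> R) : R :=
  \sum_(i in S) (i%:R - (dpred t m S i)%:R) * w i.

(* y_i - sum_(j = 0)^(L - 1) u_(i - j) *)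
Definition slack (R : realType) (I : instance R) (i : nat) : R :=
  y I i - \sum_(0 <= j < L I) u I (i - j).

Definition phi (R : realType) (I : instance R) (t : nat) : R :=
  if L I == 2 then posp (Clow I + V I - Vbar I) * u I (t - 2) else 0.

Definition alpha (R : realType) (I : instance R) (t m : nat) (S : periods I)
  : R := (m + L I - 3)%:R - gapsum t m S (fun=> 1).

Definition beta (R : realType) (I : instance R) (m : nat) : R :=
  Cup I - Vbar I - (m + L I - 3)%:R * V I.

Definition lhs (R : realType) (I : instance R) (t : nat) : R :=
  x I (t - 2) - x I (t - 1) + x I t.

Definition rhs (R : realType) (I : instance R) (t m : nat) (S : periods I)
  : R :=
  Vbar I * y I (t - 2) - (Vbar I - V I) * y I (t - 1) + Vbar I * y I t
  + V I * gapsum t m S (slack I) - phi I t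
  + alpha t m S * V I * slack I t
  + \sum_(3 <= k < L I) (k - 2)%:R * V I * u I (t - k)
  + beta I m * slack I (t - m).

Definition violation (R : realType) (I : instance R)
    (t m : nat) (S : periods I) : R := lhs I t - rhs t m S.

Definition most_violated (R : realType) (I : instance R)
    (t m : nat) (S : periods I) : Prop :=
  [/\ in_family t m S,
      0 < violation t m S
    & forall (t' m' : nat) (S' : periods I), in_family t' m' S' ->
        violation t' m' S' <= violation t m S].

(** * The model of computation: a real RAM *)

(* Programs are finite structured programs. The memory has natural-number and
   real scalars and one-dimensional arrays of both, each named by a fixed
   number; only array positions are computed at run time. Programs contain no
   real literals, and there is no rounding from reals to naturals. *)
Inductive nexp : Type :=
  | NConst of nat
  | NVar of nat
  | NGet of nat & nexp
  | NAdd of nexp & nexp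
  | NSub of nexp & nexp.

Inductive rexp : Type :=
  | ROfNat of nexp
  | RVar of nat
  | RGet of nat & nexp
  | RAdd of rexp & rexp
  | RSub of rexp & rexp
  | RMul of rexp & rexp
  | RDiv of rexp & rexp.

Inductive bexp : Type :=
  | BNle of nexp & nexp
  | BRle of rexp & rexp
  | BNot of bexp
  | BAnd of bexp & bexp.

Inductive cmd : Type :=
  | Skip
  | NSet of nat & nexp
  | NPut of nat & nexp & nexp
  | RSet of nat & rexp
  | RPut of nat & nexp & rexp
  | Seq of cmd & cmd
  | If of bexp & cmd & cmd
  | While of bexp & cmd.

Record state (R : realType) := State {
  nvar : nat -> nat;
  narr : nat -> nat -> nat;
  rvar : nat -> R;
  rarr : nat -> nat -> R }.

(* NSub is truncated subtraction. *)
Fixpoint neval (R : realType) (s : state R) (e : nexp) : nat :=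
  match e with
  | NConst k => k
  | NVar v => nvar s v
  | NGet a e1 => narr s a (neval s e1)
  | NAdd e1 e2 => (neval s e1 + neval s e2)%N
  | NSub e1 e2 => (neval s e1 - neval s e2)%N
  end.

Fixpoint reval (R : realType) (s : state R) (e : rexp) : R :=
  match e with
  | ROfNat e1 => (neval s e1)%:R
  | RVar v => rvar s v
  | RGet a e1 => rarr s a (neval s e1)
  | RAdd e1 e2 => reval s e1 + reval s e2
  | RSub e1 e2 => reval s e1 - reval s e2
  | RMul e1 e2 => reval s e1 * reval s e2
  | RDiv e1 e2 => reval s e1 / reval s e2
  end.

Fixpoint beval (R : realType) (s : state R) (b : bexp) : bool :=
  match b with
  | BNle e1 e2 => (neval s e1 <= neval s e2)%N
  | BRle e1 e2 => reval s e1 <= reval s e2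
  | BNot b1 => ~~ beval s b1
  | BAnd b1 b2 => beval s b1 && beval s b2
  end.

(* Evaluation time: one unit for each memory access, literal, arithmetic
   operation, comparison and connective. *)
Fixpoint ntime (e : nexp) : nat :=
  match e with
  | NConst _ | NVar _ => 1
  | NGet _ e1 => (ntime e1).+1
  | NAdd e1 e2 | NSub e1 e2 => (ntime e1 + ntime e2).+1
  end.

Fixpoint rtime (e : rexp) : nat :=
  match e with
  | RVar _ => 1
  | ROfNat e1 | RGet _ e1 => (ntime e1).+1
  | RAdd e1 e2 | RSub e1 e2 | RMul e1 e2 | RDiv e1 e2 =>
      (rtime e1 + rtime e2).+1
  end.

Fixpoint btime (b : bexp) : nat :=
  match b with
  | BNle e1 e2 => (ntime e1 + ntime e2).+1
  | BRle e1 e2 => (rtime e1 + rtime e2).+1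
  | BNot b1 => (btime b1).+1
  | BAnd b1 b2 => (btime b1 + btime b2).+1
  end.

Definition upd (A : Type) (f : nat -> A) (k : nat) (v : A) : nat -> A :=
  fun j => if j == k then v else f j.

Definition set_nvar (R : realType) (s : state R) (v k : nat) : state R :=
  State (upd (nvar s) v k) (narr s) (rvar s) (rarr s).

Definition set_narr (R : realType) (s : state R) (a i k : nat) : state R :=
  State (nvar s) (upd (narr s) a (upd (narr s a) i k)) (rvar s) (rarr s).

Definition set_rvar (R : realType) (s : state R) (v : nat) (r : R) : state R :=
  State (nvar s) (narr s) (upd (rvar s) v r) (rarr s).

Definition set_rarr (R : realType) (s : state R) (a i : nat) (r : R)
  : state R :=
  State (nvar s) (narr s) (rvar s) (upd (rarr s) a (upd (rarr s a) i r)).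

(* exec p s n s': started in s, the program p halts in s' after n units of
   time. *)
Inductive exec (R : realType) : cmd -> state R -> nat -> state R -> Prop :=
  | exec_skip s : exec Skip s 1 s
  | exec_nset s v e :
      exec (NSet v e) s (ntime e).+1 (set_nvar s v (neval s e))
  | exec_nput s a i e :
      exec (NPut a i e) s (ntime i + ntime e).+1
        (set_narr s a (neval s i) (neval s e))
  | exec_rset s v e :
      exec (RSet v e) s (rtime e).+1 (set_rvar s v (reval s e))
  | exec_rput s a i e :
      exec (RPut a i e) s (ntime i + rtime e).+1
        (set_rarr s a (neval s i) (reval s e))
  | exec_seq p q s s1 s2 n1 n2 :
      exec p s n1 s1 -> exec q s1 n2 s2 -> exec (Seq p q) s (n1 + n2)%N s2
  | exec_if b p q s s1 n :
      exec (if beval s b then p else q) s n s1 ->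
      exec (If b p q) s (btime b + n)%N s1
  | exec_while_end b p s :
      ~~ beval s b -> exec (While b p) s (btime b) s
  | exec_while_step b p s s1 s2 n1 n2 :
      beval s b -> exec p s n1 s1 -> exec (While b p) s1 n2 s2 ->
      exec (While b p) s (btime b + n1 + n2)%N s2.

(** * Input and output conventions *)

(* Memory not holding input is zero; array positions are the indices of the
   vectors. *)
Definition init (R : realType) (I : instance R) : state R :=
  State (nth 0%N [:: T I; L I]) (fun _ _ => 0%N)
        (nth 0 [:: Clow I; Cup I; Vbar I; V I])
        (nth (fun=> 0) [:: x I; y I; u I]).

(* Natural scalar 2 is a flag telling whether a violated inequality has been
   found; if so, scalars 3 and 4 hold t and m, and natural array 0 holds the
   indicator of S. *)
Definition out_found (R : realType) (s : state R) : bool := nvar s 2 != 0%N.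
Definition out_t (R : realType) (s : state R) : nat := nvar s 3.
Definition out_m (R : realType) (s : state R) : nat := nvar s 4.
Definition out_S (R : realType) (I : instance R) (s : state R) : periods I :=
  [set i : 'I_(T I).+1 | narr s 0 i != 0%N].

Definition separated (R : realType) (I : instance R) (s : state R) : Prop :=
  if out_found s then most_violated (out_t s) (out_m s) (out_S I s)
  else forall (t m : nat) (S : periods I), in_family t m S ->
         violation t m S <= 0.

(* Main.v *)
(* For fixed (t, m) only the term V * sum_(i in S) (i - d_i) w_i of the
   right-hand side depends on S, with w_i the slack at i minus the slack at t.
   That sum gives to every period p > t - m the weight of the least element of
   S that is >= p (or 0 if there is none), so each period gets at least
   min(0, min_(i >= p) w_i). The set of strict records of w, read downwards
   from the largest admissible period and starting from 0, attains all these
   bounds at once, and one linear scan finds it. Scanning for each of the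
   O(T^2) pairs (t, m) takes time O(T^3). *)

Require Import Defs.
From HB Require Import structures.
From mathcomp Require Import all_boot all_order all_algebra.
From mathcomp Require Import reals.
From mathcomp Require Import zify ring.
Set Implicit Arguments.
Unset Strict Implicit.
Unset Printing Implicit Defensive.
Import Order.TTheory GRing.Theory Num.Theory.
Local Open Scope ring_scope.

(** * Optimal sets *)

Section NextValue.
Variable R : realType.
Implicit Types (b : pred nat) (w : nat -> R).

(* With p = n.+1 - k: the value of w at the least element of b in [p, n], or 0
   if there is none. *)
Fixpoint next_value (n : nat) b w (k : nat) : R :=
  if k is k'.+1 then
    if b (n - k')%N then w (n - k')%N else next_value n b w k'
  else 0.

(* With p = n.+1 - k: the minimum of 0 and of the w i with i in [p, n] and
   b i. *)
Fixpoint suffix_min (n : nat) b w (k : nat) : R :=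
  if k is k'.+1 then
    if b (n - k')%N && (w (n - k')%N < suffix_min n b w k')
    then w (n - k')%N else suffix_min n b w k'
  else 0.

(** The count [n - i] starts the suffix at [i.+1], so [i] competes with strictly later indices and
    with 0 only. *)
Definition records (n : nat) b w : pred nat :=
  fun i => b i && (w i < suffix_min n b w (n - i)).

(** Being a record at [n - k] is exactly the branch condition of [suffix_min], so the two recursions
    coincide. *)
Lemma next_value_records n b w k : (k <= n.+1)%N ->
  next_value n (records n b w) w k = suffix_min n b w k.
Proof.
elim: k => //= k IHk le_kn; rewrite /records subKn // IHk //.
exact: ltnW.
Qed.

(** The next value is 0 or some [w i] with [b' i], and each of these competes in the minimum. *)
Lemma suffix_min_le_next_value n b b' w k :
  (forall i, (i <= n)%N -> b' i -> b i) ->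
  suffix_min n b w k <= next_value n b' w k.
Proof.
move=> sub_b; elim: k => //= k IHk.
case: (boolP (b' (n - k)%N)) => [b'i|_].
  by rewrite (sub_b _ _ b'i) ?leq_subr //=; case: ltP.
by case: ifP => // /andP[_ /ltW le_w]; apply: le_trans le_w IHk.
Qed.

Lemma eq_next_value n b b' w k : (forall i, (i <= n)%N -> b i = b' i) ->
  next_value n b w k = next_value n b' w k.
Proof. by move=> eq_b; elim: k => //= k ->; rewrite eq_b ?leq_subr. Qed.

End NextValue.

(** * The gap sum as a sum over periods *)

Section GapSum.
Variables (R : realType) (I : instance R).
Implicit Types (S : periods I) (w : nat -> R).

(** [inord] sends numbers above [T I] to period 0, so this is meaningful up to [T I] only. *)
Definition in_periods S : pred nat := fun i => inord i \in S.

(** Raising the bound by one admits the single new candidate [q.+1], which exceeds [t - m] and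
    therefore counts only if it lies in [S]. *)
Lemma dpred_step t m S q : (t <= T I)%N -> (t - m <= q < T I)%N ->
  dpred t m S q.+2 = if in_periods S q.+1 then q.+1 else dpred t m S q.+1.
Proof.
move=> le_tT /andP[le_q lt_qT]; rewrite /in_periods.
have vq : (inord q.+1 : 'I_(T I).+1) = q.+1 :> nat by rewrite inordK.
case: ifP => Sq; last first.
  apply: eq_bigl => a; rewrite !ltnS [(a <= q.+1)%N]leq_eqVlt.
  case: (altP (a =P q.+1 :> nat)) => //= eq_a.
  have -> : a \in S = false.
    by rewrite -Sq; congr (_ \in S); apply: ord_inj; rewrite vq.
  by rewrite eq_a /=; lia.
apply/eqP; rewrite eqn_leq; apply/andP; split.
  by apply/bigmax_leqP => a /andP[_].
rewrite -[X in (X <= _)%N]vq.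
apply: (leq_bigmax_cond (F := fun a : 'I_(T I).+1 => a : nat)).
by rewrite Sq vq /=.
Qed.

Lemma dpred_start t m S : (t <= T I)%N ->
  (forall i, i \in S -> (t - m < i)%N) -> dpred t m S (t - m).+1 = (t - m)%N.
Proof.
move=> le_tT Sgt.
have v : (inord (t - m) : 'I_(T I).+1) = (t - m)%N :> nat.
  by rewrite inordK // ltnS (leq_trans (leq_subr _ _)).
apply/eqP; rewrite eqn_leq; apply/andP; split.
  by apply/bigmax_leqP => a /andP[_].
rewrite -[X in (X <= _)%N]v.
apply: (leq_bigmax_cond (F := fun a : 'I_(T I).+1 => a : nat)).
by rewrite v eqxx orbT /=.
Qed.

(* Each i in S is counted once for every p in ]d_i, i], that is, for every p
   whose least successor in S is i. *)
Lemma gapsum_next_value t m S w : (t <= T I)%N ->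
    (forall i, i \in S -> (t - m < i)%N) ->
  gapsum t m S w = \sum_(0 <= j < (T I).+1 | (t - m < T I - j)%N)
                      next_value (T I) (in_periods S) w j.+1.
Proof.
move=> le_tT Sgt; set a := (t - m)%N; set b := in_periods S.
(* The count [T I - p] makes [N p] the weight at the least element of [S] in [[p.+1, T I]]. *)
pose N p := next_value (T I) b w (T I - p).
have le_aT : (a <= T I)%N by apply: leq_trans (leq_subr _ _) le_tT.
(* The second term is the part up to [q] of the gap still open there, weighted by the element of [S]
   that will close it. It vanishes at [q = a], and at [q = T I], where [N q] is 0. *)
have partial q : (a <= q <= T I)%N ->
    \sum_(i in S | (i <= q)%N) (i%:R - (dpred t m S i)%:R) * w i
      + (q%:R - (dpred t m S q.+1)%:R) * N q = \sum_(a <= p < q) N p.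
  elim: q => [|q IHq] /andP[le_aq le_qT].
    have a0 : a = 0%N by lia.
    rewrite big_geq // big_pred0 => [|i]; last first.
      by apply/negP => /andP[/Sgt]; rewrite -/a a0; lia.
    have -> : dpred t m S 1 = 0%N by rewrite -[1%N]/(0.+1) -a0 dpred_start.
    by rewrite subrr mul0r addr0.
  move: le_aq; rewrite leq_eqVlt => /orP[/eqP eq_aq|lt_aq].
    rewrite -eq_aq big_geq // big_pred0 => [|i]; last first.
      by apply/negP => /andP[/Sgt]; rewrite -/a; lia.
    by rewrite dpred_start // subrr mul0r addr0.
  rewrite big_nat_recr //= -IHq; last by lia.
  rewrite dpred_step //; last by lia.
  have eN : N q = if b q.+1 then w q.+1 else N q.+1.
    rewrite /N; have -> : (T I - q = (T I - q.+1).+1)%N by lia.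
    by rewrite /= subKn.
  have vq : (inord q.+1 : 'I_(T I).+1) = q.+1 :> nat by rewrite inordK.
  have eqq (i : 'I_(T I).+1) : i = q.+1 :> nat -> i = inord q.+1.
    by move=> e; apply: ord_inj; rewrite vq.
  (* If [q.+1] is in [S], the open gap closes and becomes a summand; otherwise it grows by one with
     the same weight. *)
  rewrite -/b eN; case: ifP => bq.
    rewrite (bigD1 (inord q.+1)) /=; last by rewrite vq leqnn andbT.
    rewrite vq (eq_bigl (fun i : 'I_(T I).+1 => (i \in S) && (i <= q)%N)).
      by rewrite -[in LHS]natr1; ring.
    move=> i; have -> : (i != inord q.+1) = (i != q.+1 :> nat).
      by rewrite -val_eqE /= vq.
    by case: (i \in S) => //=; lia.
  rewrite (eq_bigl (fun i : 'I_(T I).+1 => (i \in S) && (i <= q)%N)).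
    by rewrite -[in LHS]natr1; ring.
  move=> i; have [Si|//] := boolP (i \in S).
  suff : (i : nat) <> q.+1 by move=> /=; lia.
  by move=> /eqq ei; move: bq; rewrite /b /in_periods -ei Si.
have := partial (T I); rewrite le_aT leqnn => /(_ isT).
rewrite {1}/N subnn /= mulr0 addr0.
rewrite (eq_bigl (fun i : 'I_(T I).+1 => i \in S)) => [|i]; last first.
  by rewrite -ltnS ltn_ord andbT.
rewrite /gapsum => ->.
(* The substitution is [p = T I - j.+1]; the filter cuts the range [[0, T I]] of the scan down to
   [j < T I - a]. *)
transitivity (\sum_(0 <= j < T I - a) next_value (T I) b w j.+1); last first.
  rewrite [LHS](big_nat_widen _ _ (T I).+1); last by lia.
  by apply: eq_bigl => j /=; lia.
rewrite big_nat_rev /= -{1}[a]add0n big_addn.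
rewrite big_nat [RHS]big_nat; apply: eq_bigr => j lt_j.
rewrite /N; have -> // : (T I - (a + T I - (j + a).+1) = j.+1)%N by lia.
Qed.

Lemma gapsum_shift t m S w c :
  gapsum t m S w - gapsum t m S (fun=> 1) * c = gapsum t m S (fun i => w i - c).
Proof.
rewrite /gapsum mulr_suml -sumrB; apply: eq_bigr => i _.
by rewrite mulr1 mulrBr.
Qed.

End GapSum.

(** * The largest violation for a fixed pair of t and m *)

Section Separation.
Variables (R : realType) (I : instance R).

(** This mirrors the test in [consider]; the bound [t <= T I] comes from the loop there. *)
Definition legal (t m : nat) : bool :=
  [&& (L I + 1 <= t)%N, (3 - L I <= m)%N, (m <= t - L I - 1)%N
    & m%:R <= mcap I].

(* For L >= 2 the upper bound below is t - 1 if L >= 3 and t - 2 if L = 2. *)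
Definition eligible (t m : nat) : pred nat :=
  fun i => (t - m + 1 <= i)%N && (i <= t - 1 - (3 - L I))%N.

Definition weight (t i : nat) : R := slack I i - slack I t.

Definition opt_min (t m k : nat) : R :=
  suffix_min (T I) (eligible t m) (weight t) k.

(** The parameter [k] makes this the accumulator of [scan] after [k] iterations. *)
Definition opt_gapsum (t m k : nat) : R :=
  \sum_(0 <= j < k | (t - m < T I - j)%N) opt_min t m j.+1.

Definition opt_set (t m : nat) : periods I :=
  [set i : 'I_(T I).+1 | records (T I) (eligible t m) (weight t) i].

Definition base_violation (t m : nat) : R :=
  lhs I t - (Vbar I * y I (t - 2) - (Vbar I - V I) * y I (t - 1)
    + Vbar I * y I t - phi I t + (m + L I - 3)%:R * V I * slack I t
    + \sum_(3 <= k < L I) (k - 2)%:R * V I * u I (t - k)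
    + beta I m * slack I (t - m)).

Definition opt_violation (t m : nat) : R :=
  base_violation t m - V I * opt_gapsum t m (T I).+1.

(** The gap sum inside [alpha] multiplies the slack at [t], so [gapsum_shift] absorbs it into the
    weights. *)
Lemma violationE t m (S : periods I) :
  violation t m S = base_violation t m - V I * gapsum t m S (weight t).
Proof.
rewrite /weight -gapsum_shift /violation /rhs /alpha /base_violation.
ring.
Qed.

Lemma eligibleE t m i : (2 <= L I)%N ->
  eligible t m i = (t - m + 1 <= i <= if 3 <= L I then t - 1 else t - 2)%N.
Proof. by move=> L2; rewrite /eligible; case: ifP => h; congr andb; lia. Qed.

Lemma in_familyE t m (S : periods I) : (2 <= L I)%N ->
  in_family t m S <-> [/\ legal t m, (t <= T I)%N
                       & forall i, i \in S -> eligible t m i].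
Proof.
move=> L2; rewrite /in_family /legal; split.
  case=> /andP[-> ->] /andP[-> ->] -> h; split=> // i /h; by rewrite eligibleE.
case=> /and4P[-> -> -> ->] -> h; split=> // i /h; by rewrite eligibleE.
Qed.

(** Since [V I] is positive, it suffices to bound the gap sum from below, which is done term by
    term. *)
Lemma opt_violation_max t m (S : periods I) : (2 <= L I)%N -> 0 < V I ->
  in_family t m S -> violation t m S <= opt_violation t m.
Proof.
move=> L2 V0 /(in_familyE _ _ _ L2)[_ tT Sel].
rewrite violationE /opt_violation lerD2l lerN2 ler_pM2l //.
rewrite gapsum_next_value // => [|i /Sel /andP[]]; last by rewrite addn1.
apply: ler_sum => j _; apply: suffix_min_le_next_value => i iT Si.
by have := Sel _ Si; rewrite inordK.
Qed.

Lemma opt_set_in_family t m : (2 <= L I)%N -> legal t m -> (t <= T I)%N ->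
  in_family t m (opt_set t m).
Proof.
by move=> L2 tm tT; apply/(in_familyE _ _ _ L2); split=> // i;
  rewrite inE => /andP[].
Qed.

Lemma violation_opt_set t m : (t <= T I)%N ->
  violation t m (opt_set t m) = opt_violation t m.
Proof.
move=> tT; rewrite violationE /opt_violation gapsum_next_value //; last first.
  by move=> i; rewrite inE => /andP[/andP[+ _] _]; rewrite addn1.
congr (_ - _ * _); apply: congr_big_nat => // j /andP[_ /andP[_ jT]].
rewrite -/(opt_min t m j.+1) /opt_min -next_value_records //.
by apply: eq_next_value => i iT; rewrite /in_periods inE inordK.
Qed.

End Separation.
(** * Running time of programs *)

Section Programs.
Variable R : realType.
Implicit Types (s : state R) (p : cmd) (Q : state R -> Prop).

(* An upper bound on the running time of p when no loop makes more than N
   iterations. *)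
Fixpoint cost (N : nat) p : nat :=
  match p with
  | Skip => 1
  | NSet _ e => (ntime e).+1
  | NPut _ i e => (ntime i + ntime e).+1
  | RSet _ e => (rtime e).+1
  | RPut _ i e => (ntime i + rtime e).+1
  | Seq p q => cost N p + cost N q
  | If b p q => btime b + (cost N p + cost N q)
  | While b p => btime b + N * (btime b + cost N p)
  end.

Fixpoint loop_depth p : nat :=
  match p with
  | Seq p q | If _ p q => maxn (loop_depth p) (loop_depth q)
  | While _ p => (loop_depth p).+1
  | _ => 0
  end.

(** Each level of nesting contributes at most one factor [N]; the rest is the cost with one
    iteration per loop. *)
Lemma cost_le N p : (0 < N)%N -> (cost N p <= cost 1 p * N ^ loop_depth p)%N.
Proof.
move=> N0.
elim: p => [|v e|a i e|v e|a i e|p IHp q IHq|b p IHp q IHq|b p IHp] /=;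
  rewrite ?expn0 ?muln1 //.
- rewrite mulnDl; apply: leq_add.
    by rewrite (leq_trans IHp) // leq_mul2l leq_pexp2l ?leq_maxl ?orbT.
  by rewrite (leq_trans IHq) // leq_mul2l leq_pexp2l ?leq_maxr ?orbT.
- rewrite !mulnDl; apply: leq_add; last apply: leq_add.
  + by rewrite leq_pmulr ?expn_gt0 ?N0.
  + by rewrite (leq_trans IHp) // leq_mul2l leq_pexp2l ?leq_maxl ?orbT.
  + by rewrite (leq_trans IHq) // leq_mul2l leq_pexp2l ?leq_maxr ?orbT.
- rewrite mul1n !mulnDl mulnDr; apply: leq_add.
    by rewrite leq_pmulr ?expn_gt0 ?N0.
  apply: leq_add.
    by rewrite mulnC leq_mul2l expnS leq_pmulr ?orbT ?expn_gt0 ?N0.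
  by rewrite expnS mulnCA leq_mul2l IHp orbT.
Qed.

(** Total correctness and the time bound are bundled, so the running time is accounted for once, in
    the rules below. *)
Definition runs (N : nat) p s Q : Prop :=
  exists n s', [/\ exec p s n s', (n <= cost N p)%N & Q s'].

Lemma runs_weaken N p s Q Q' : (forall s', Q s' -> Q' s') ->
  runs N p s Q -> runs N p s Q'.
Proof. by move=> QQ' [n [s' [ps np /QQ' Qs]]]; exists n, s'. Qed.

Lemma runs_seq N p q s Q :
  runs N p s (fun s1 => runs N q s1 Q) -> runs N (Seq p q) s Q.
Proof.
move=> [n1 [s1 [ps1 le1 [n2 [s2 [qs2 le2 Qs]]]]]].
by exists (n1 + n2)%N, s2; split; [apply: exec_seq qs2 | apply: leq_add |].
Qed.

Lemma runs_if N b p q s Q :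
  (beval s b -> runs N p s Q) -> (~~ beval s b -> runs N q s Q) ->
  runs N (If b p q) s Q.
Proof.
move=> runs_p runs_q.
have [n [s' [ex le_n Qs]]] : exists n s',
    [/\ exec (if beval s b then p else q) s n s',
       (n <= cost N p + cost N q)%N & Q s'].
  case: (boolP (beval s b)) => [/runs_p|/runs_q] [n [s' [ex le_n Qs]]];
    exists n, s'; split=> //; rewrite (leq_trans le_n) ?leq_addr ?leq_addl //.
exists (btime b + n)%N, s'; split=> //=; first exact: exec_if.
by rewrite leq_add2l.
Qed.

Fixpoint loop_free p : bool :=
  match p with
  | Seq p q | If _ p q => loop_free p && loop_free q
  | While _ _ => false
  | _ => true
  end.

(** The value on loops is a placeholder; [runs_run] assumes [loop_free]. *)
Fixpoint run p s : state R :=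
  match p with
  | Skip | While _ _ => s
  | NSet v e => set_nvar s v (neval s e)
  | NPut a i e => set_narr s a (neval s i) (neval s e)
  | RSet v e => set_rvar s v (reval s e)
  | RPut a i e => set_rarr s a (neval s i) (reval s e)
  | Seq p q => run q (run p s)
  | If b p q => if beval s b then run p s else run q s
  end.

Lemma runs_run N p s Q : loop_free p -> Q (run p s) -> runs N p s Q.
Proof.
elim: p s Q => [|v e|a i e|v e|a i e|p IHp q IHq|b p IHp q IHq|//] s Q /=.
- by exists 1%N, s; split=> //; apply: exec_skip.
- by do 2!eexists; split; [apply: exec_nset | |].
- by do 2!eexists; split; [apply: exec_nput | |].
- by do 2!eexists; split; [apply: exec_rset | |].
- by do 2!eexists; split; [apply: exec_rput | |].
- by case/andP=> fp fq Qs; apply/runs_seq/IHp/IHq.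
- case/andP=> fp fq Qs; apply: runs_if => [bs|/negPf bs]; rewrite bs in Qs;
    [exact: IHp | exact: IHq].
Qed.

(** The invariant is indexed by completed iterations and decides the test, so the loop stops after
    exactly [n] of them. *)
Lemma runs_while N b p n (Inv : nat -> state R -> Prop) s : (n <= N)%N ->
  (forall k s, (k <= n)%N -> Inv k s -> beval s b = (k < n)%N) ->
  (forall k s, (k < n)%N -> Inv k s -> runs N p s (Inv k.+1)) ->
  Inv 0%N s -> runs N (While b p) s (Inv n).
Proof.
move=> le_nN test step Inv0.
suff loop j k s1 : (k + j)%N = n -> Inv k s1 -> exists m s2,
    [/\ exec (While b p) s1 m s2, (m <= btime b + j * (btime b + cost N p))%N
      & Inv n s2].
  have [m [s2 [ex le_m Inv2]]] := loop n 0%N s (add0n n) Inv0.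
  exists m, s2; split=> //; rewrite (leq_trans le_m) //=.
  by rewrite leq_add2l leq_mul2r le_nN orbT.
elim: j k s1 => [|j IHj] k s1 eq_n Inv1.
  rewrite addn0 in eq_n; exists (btime b), s1; split; rewrite -?eq_n //.
    by apply: exec_while_end; rewrite (test k) // -eq_n ?ltnn.
  by rewrite mul0n addn0.
have lt_kn : (k < n)%N by lia.
have [m1 [s2 [ex1 le1 Inv2]]] := step _ _ lt_kn Inv1.
have [|m2 [s3 [ex2 le2 Inv3]]] := IHj k.+1 s2 _ Inv2; first by lia.
exists (btime b + m1 + m2)%N, s3; split=> //; last by lia.
by apply: exec_while_step ex1 ex2; rewrite (test k) // ltnW.
Qed.

Definition For (v : nat) (e : nexp) p : cmd :=
  Seq (NSet v (NConst 0))
    (While (BNle (NAdd (NVar v) (NConst 1)) e)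
       (Seq p (NSet v (NAdd (NVar v) (NConst 1))))).

(** The bound [e] is evaluated anew at each test, so [Inv] must fix its value; the counter is
    tracked beside [Inv], which must survive its increments. *)
Lemma runs_for N v e p n (Inv : nat -> state R -> Prop) s :
    (n <= N)%N ->
    (forall k s, Inv k s -> neval s e = n) ->
    (forall k s j, Inv k s -> Inv k (set_nvar s v j)) ->
    Inv 0%N s ->
    (forall k s, (k < n)%N -> nvar s v = k -> Inv k s ->
       runs N p s (fun s' => nvar s' v = k /\ Inv k.+1 s')) ->
  runs N (For v e p) s (Inv n).
Proof.
move=> le_nN eval_e stable Inv0 step; apply: runs_seq; apply: runs_run => //=.
apply: runs_weaken (fun s' (h : nvar s' v = n /\ Inv n s') => proj2 h) _.
apply: (runs_while (Inv := fun k s' => nvar s' v = k /\ Inv k s')) => //.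
- by move=> k s1 _ [vk Ik] /=; rewrite vk (eval_e _ _ Ik) addn1.
- move=> k s1 lt_kn [vk Ik]; apply: runs_seq.
  apply: runs_weaken (step _ _ lt_kn vk Ik) => s2 [vk2 Ik2].
  apply: runs_run => //=; split; last exact: stable.
  by rewrite /upd eqxx vk2 addn1.
- by split; [rewrite /= /upd eqxx | apply: stable].
Qed.

(* The memory written by a program: scalars and arrays are tagged 0, 1 for
   naturals and 2, 3 for reals. *)
Fixpoint writes p : seq (nat * nat) :=
  match p with
  | Skip => [::]
  | NSet v _ => [:: (0%N, v)]
  | NPut a _ _ => [:: (1%N, a)]
  | RSet v _ => [:: (2%N, v)]
  | RPut a _ _ => [:: (3%N, a)]
  | Seq p q | If _ p q => writes p ++ writes q
  | While _ p => writes p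
  end.

Definition frame p s s' : Prop :=
  [/\ forall v, (0%N, v) \notin writes p -> nvar s' v = nvar s v,
      forall a, (1%N, a) \notin writes p -> narr s' a = narr s a,
      forall v, (2%N, v) \notin writes p -> rvar s' v = rvar s v
    & forall a, (3%N, a) \notin writes p -> rarr s' a = rarr s a].

Lemma frame_sub p q s s' : {subset writes p <= writes q} ->
  frame p s s' -> frame q s s'.
Proof.
move=> sub [h0 h1 h2 h3].
by split=> v nv; [apply: h0 | apply: h1 | apply: h2 | apply: h3];
  apply: contra nv => /sub.
Qed.

Lemma frame_trans p s1 s2 s3 : frame p s1 s2 -> frame p s2 s3 -> frame p s1 s3.
Proof.
move=> [h0 h1 h2 h3] [g0 g1 g2 g3].
by split=> v nv; rewrite ?g0 ?g1 ?g2 ?g3 ?h0 ?h1 ?h2 ?h3.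
Qed.

Lemma exec_frame p s n s' : exec p s n s' -> frame p s s'.
Proof.
elim=> {p s n s'} //.
- by move=> s v e; split=> //= w; rewrite inE xpair_eqE /= /upd => /negPf->.
- by move=> s a i e; split=> //= w; rewrite inE xpair_eqE /= /upd => /negPf->.
- by move=> s v e; split=> //= w; rewrite inE xpair_eqE /= /upd => /negPf->.
- by move=> s a i e; split=> //= w; rewrite inE xpair_eqE /= /upd => /negPf->.
- move=> p q s s1 s2 n1 n2 _ f1 _ f2; apply: frame_trans (frame_sub _ f2).
    by apply: frame_sub f1 => l /= ; rewrite mem_cat => ->.
  by move=> l /=; rewrite mem_cat orbC => ->.
- move=> b p q s s1 n _; apply: frame_sub => l.
  by case: ifP => _ /=; rewrite mem_cat => ->; rewrite ?orbT.
- move=> b p s s1 s2 n1 n2 _ _ f1 _ f2; exact: frame_trans f1 f2.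
Qed.

(** This lets specifications state only what is computed; invariants on untouched memory are carried
    over by the frame. *)
Lemma runs_frame N p s Q :
  runs N p s Q -> runs N p s (fun s' => Q s' /\ frame p s s').
Proof.
move=> [n [s' [ex le_n Qs]]]; exists n, s'; split=> //; split=> //.
exact: exec_frame ex.
Qed.

End Programs.

(** * The separation program *)

Declare Scope nexp_scope.
Delimit Scope nexp_scope with nx.
Declare Scope rexp_scope.
Delimit Scope rexp_scope with rx.
Local Notation "# v" := (NVar v) (at level 2, format "# v") : nexp_scope.
Local Notation "' k" := (NConst k) (at level 2, format "' k") : nexp_scope.
Local Notation "e1 + e2" := (NAdd e1 e2) : nexp_scope.
Local Notation "e1 - e2" := (NSub e1 e2) : nexp_scope.
Local Notation "# v" := (RVar v) (at level 2, format "# v") : rexp_scope.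
Local Notation "n %:R" := (ROfNat n%nx) : rexp_scope.
Local Notation "a @ e" := (RGet a e%nx) (at level 30) : rexp_scope.
Local Notation "e1 + e2" := (RAdd e1 e2) : rexp_scope.
Local Notation "e1 - e2" := (RSub e1 e2) : rexp_scope.
Local Notation "e1 * e2" := (RMul e1 e2) : rexp_scope.
Local Notation "e1 / e2" := (RDiv e1 e2) : rexp_scope.
Local Notation "e1 <=n e2" := (BNle e1%nx e2%nx) (at level 70).
Local Notation "e1 <=r e2" := (BRle e1%rx e2%rx) (at level 70).
Local Notation "p ;; q" := (Seq p q) (at level 90, right associativity).

Local Notation vT := 0%N.
Local Notation vL := 1%N.
Local Notation vfound := 2%N.
Local Notation vt := 3%N.
Local Notation vm := 4%N.
Local Notation vbest_t := 5%N.
Local Notation vbest_m := 6%N.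
Local Notation vi := 7%N.
Local Notation vj := 8%N.

Local Notation rClow := 0%N.
Local Notation rCup := 1%N.
Local Notation rVbar := 2%N.
Local Notation rV := 3%N.
Local Notation rcap := 4%N.
Local Notation rbest := 5%N.
Local Notation rmin := 6%N.
Local Notation rgap := 7%N.
Local Notation rsum := 8%N.
Local Notation rviol := 9%N.

Local Notation ax := 0%N.
Local Notation ay := 1%N.
Local Notation au := 2%N.
Local Notation aslack := 3%N.
Local Notation aS := 0%N.

Definition compute_cap : cmd :=
  RSet rcap ((#rCup - #rVbar) / #rV - (#vL)%:R + ('3)%:R)%rx ;;
  If (#rcap <=r ('0)%:R) (RSet rcap (('0)%:R)%rx) Skip.

Definition slack_step : cmd := RSet rsum (#rsum - au @ (#vi - #vj))%rx.

Definition compute_slack : cmd :=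
  For vi (#vT + '1)%nx (
    RSet rsum (ay @ #vi)%rx ;;
    For vj (#vL)%nx slack_step ;;
    RPut aslack (#vi)%nx (#rsum)%rx).

(* Period i is visited as T - vi, from T down to 0. *)
Definition scan_step : cmd :=
  NPut aS (#vT - #vi)%nx ('0)%nx ;;
  If (BAnd (#vt - #vm + '1 <=n #vT - #vi)
     (BAnd (#vT - #vi <=n #vt - '1 - ('3 - #vL))
     (BNot (#rmin <=r aslack @ (#vT - #vi) - aslack @ #vt))))
    (RSet rmin (aslack @ (#vT - #vi) - aslack @ #vt)%rx ;;
     NPut aS (#vT - #vi)%nx ('1)%nx)
    Skip ;;
  If (#vt - #vm + '1 <=n #vT - #vi) (RSet rgap (#rgap + #rmin)%rx) Skip.

(** All indicator entries in [[0, T I]] are rewritten, so nothing of an earlier set survives. *)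
Definition scan : cmd :=
  RSet rmin (('0)%:R)%rx ;;
  RSet rgap (('0)%:R)%rx ;;
  For vi (#vT + '1)%nx scan_step.

Definition ramp_step : cmd :=
  RSet rsum (#rsum + (#vj + '3 - '2)%:R * #rV * au @ (#vt - (#vj + '3)))%rx.

Definition compute_ramp : cmd :=
  RSet rsum (('0)%:R)%rx ;; For vj (#vL - '3)%nx ramp_step.

(** The term [phi] raises the violation and is added by a guarded assignment; for [L I >= 2] the
    test [L <= 2] means [L = 2], and the second test realizes the positive part. *)
Definition evaluate : cmd :=
  RSet rviol (ax @ (#vt - '2) - ax @ (#vt - '1) + ax @ #vt
    - (#rVbar * ay @ (#vt - '2) - (#rVbar - #rV) * ay @ (#vt - '1)
       + #rVbar * ay @ #vt + #rV * #rgap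
       + (#vm + #vL - '3)%:R * #rV * aslack @ #vt + #rsum
       + (#rCup - #rVbar - (#vm + #vL - '3)%:R * #rV)
         * aslack @ (#vt - #vm)))%rx ;;
  If (BAnd (#vL <=n '2) (('0)%:R <=r #rClow + #rV - #rVbar))
    (RSet rviol (#rviol + (#rClow + #rV - #rVbar) * au @ (#vt - '2))%rx)
    Skip.

(** As [rbest] starts at 0, a strict improvement is always a genuine violation. *)
Definition update : cmd :=
  If (BNot (#rviol <=r #rbest))
    (NSet vfound ('1)%nx ;; NSet vbest_t (#vt)%nx ;; NSet vbest_m (#vm)%nx ;;
     RSet rbest (#rviol)%rx)
    Skip.

Definition consider : cmd :=
  If (BAnd (#vL + '1 <=n #vt) (BAnd ('3 - #vL <=n #vm)
     (BAnd (#vm <=n #vt - #vL - '1) ((#vm)%:R <=r #rcap))))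
    (scan ;; compute_ramp ;; evaluate ;; update)
    Skip.

Definition search : cmd :=
  For vt (#vT + '1)%nx (For vm (#vT + '1)%nx consider).

(** The search stores only the best pair; one more scan at that pair recovers the set. *)
Definition separation : cmd :=
  compute_cap ;; compute_slack ;; search ;;
  If ('1 <=n #vfound)
    (NSet vt (#vbest_t)%nx ;; NSet vm (#vbest_m)%nx ;; scan)
    Skip.

(** * Correctness of the separation program *)

Section Correctness.
Variables (R : realType) (I : instance R).
Hypothesis L_ge2 : (2 <= L I)%N.
Hypothesis L_lt_T : (L I + 1 <= T I)%N.
Hypothesis V_gt0 : 0 < V I.
Implicit Type s : state R.

Local Notation N := (T I).+1.

Definition inputs s : Prop :=
  [/\ nvar s vT = T I, nvar s vL = L I,
      [/\ rvar s rClow = Clow I, rvar s rCup = Cup I, rvar s rVbar = Vbar I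
        & rvar s rV = V I]
    & [/\ rarr s ax = x I, rarr s ay = y I & rarr s au = u I]].

Definition input_places : seq (nat * nat) :=
  [:: (0, vT); (0, vL); (2, rClow); (2, rCup); (2, rVbar); (2, rV);
      (3, ax); (3, ay); (3, au)]%N.

(** The condition on [writes p] is a boolean computation, so for concrete programs [isT] proves
    it. *)
Lemma inputs_frame p s s' : frame p s s' ->
  all (fun l => l \notin writes p) input_places -> inputs s -> inputs s'.
Proof.
move=> [f0 _ f2 f3]; rewrite /input_places /=.
case/and5P=> h1 h2 h3 h4 /and5P[h5 h6 h7 h8 /andP[h9 _]].
by case=> i1 i2 [i3 i4 i5 i6] [i7 i8 i9];
  split; rewrite ?f0 //; split; rewrite ?f2 ?f3.
Qed.

Definition ready s : Prop :=
  [/\ inputs s, rvar s rcap = mcap I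
    & forall i, (i <= T I)%N -> rarr s aslack i = slack I i].

Lemma ready_frame p s s' : frame p s s' ->
  all (fun l => l \notin writes p)
    [:: (2, rcap)%N, (3, aslack)%N & input_places] ->
  ready s -> ready s'.
Proof.
move=> fr /and3P[h1 h2 h3] [i1 i2 i3]; have [_ _ f2 f3] := fr.
split; first exact: (inputs_frame fr h3).
  by rewrite f2.
by move=> i iT; rewrite f3 // i3.
Qed.

Lemma compute_cap_spec s : inputs s ->
  runs N compute_cap s (fun s' => inputs s' /\ rvar s' rcap = mcap I).
Proof.
case=> i1 i2 [i3 i4 i5 i6] i7; apply: runs_run => //.
rewrite /= /upd /= i2 i4 i5 i6.
by case: ifP => h; split=> //=; rewrite /upd /= ?i2 ?i4 ?i5 ?i6 /mcap /posp;
  case: lerP h.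
Qed.

Lemma slack_loop_spec s : inputs s -> rvar s rsum = y I (nvar s vi) ->
  runs N (For vj (#vL)%nx slack_step) s
    (fun s' => rvar s' rsum = slack I (nvar s vi)).
Proof.
move=> in_s sum_s.
apply: (runs_weaken (Q := fun s' => [/\ nvar s' vi = nvar s vi, inputs s'
  & rvar s' rsum = slack I (nvar s vi)])); first by move=> s' [].
apply: (runs_for (Inv := fun j s' => [/\ nvar s' vi = nvar s vi, inputs s'
  & rvar s' rsum = y I (nvar s vi)
      - \sum_(0 <= i < j) u I (nvar s vi - i)])) => //.
- by lia.
- by move=> j s1 [_ []].
- by split=> //; rewrite big_geq // subr0.
move=> j s1 _ vj1 [vi1 in1 sum1]; apply: runs_run => //=.
have [_ _ _ [_ _ u1]] := in1; split=> //; split=> //.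
by rewrite /upd /= sum1 u1 vi1 vj1 big_nat_recr //= opprD addrA.
Qed.

Lemma compute_slack_spec s : inputs s -> rvar s rcap = mcap I ->
  runs N compute_slack s ready.
Proof.
move=> in_s cap_s.
apply: (runs_weaken (Q := fun s' => [/\ inputs s', rvar s' rcap = mcap I
  & forall i, (i < N)%N -> rarr s' aslack i = slack I i])).
  by move=> s' [].
apply: (runs_for (Inv := fun n s' => [/\ inputs s', rvar s' rcap = mcap I
  & forall i, (i < n)%N -> rarr s' aslack i = slack I i])) => //.
- by move=> k s1 [[/= -> _ _ _] _ _]; rewrite addn1.
move=> k s1 lt_k vi1 [in1 cap1 sl1]; apply: runs_seq; apply: runs_run => //.
apply: runs_seq; set s2 := run _ s1.
have in2 : inputs s2 by [].
have sum2 : rvar s2 rsum = y I (nvar s2 vi).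
  by have [_ _ _ [_ y1 _]] := in1; rewrite /= /upd /= y1 vi1.
apply: runs_weaken (runs_frame (slack_loop_spec in2 sum2)) => s3 [sum3 fr3].
have in3 := inputs_frame fr3 isT in2.
have [f0 _ f2 f3] := fr3.
have vi3 : nvar s3 vi = k by rewrite f0.
apply: runs_run => //=; split=> //; split=> //=; first by rewrite f2.
move=> i; rewrite /upd /= vi3 ltnS leq_eqVlt.
case: eqP => [-> _|_ /= /sl1 <-]; first by rewrite sum3 /= vi1.
by rewrite f3.
Qed.

Lemma compute_ramp_spec s : inputs s ->
  runs N compute_ramp s (fun s' => rvar s' rsum =
    \sum_(3 <= k < L I) (k - 2)%:R * V I * u I (nvar s vt - k)).
Proof.
move=> in_s; apply: runs_seq; apply: runs_run => //.
apply: (runs_weaken (Q := fun s' => [/\ nvar s' vt = nvar s vt, inputs s'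
  & rvar s' rsum = \sum_(3 <= k < (L I - 3) + 3)
      (k - 2)%:R * V I * u I (nvar s vt - k)])).
  (* For [L I = 2] the truncated difference is 0 and both sums are empty. *)
  move=> s' [_ _ ->]; have [L3|L3] := leqP 3 (L I); first by rewrite subnK.
  by rewrite big_geq ?[RHS]big_geq //; lia.
apply: (runs_for (Inv := fun j s' => [/\ nvar s' vt = nvar s vt, inputs s'
  & rvar s' rsum = \sum_(3 <= k < j + 3)
      (k - 2)%:R * V I * u I (nvar s vt - k)])) => //.
- by lia.
- by move=> j s1 [_ [/= _ -> _ _] _].
- by split=> //; rewrite /= /upd /= big_geq.
move=> j s1 _ vj1 [vt1 in1 sum1]; apply: runs_run => //=.
have [_ _ [_ _ _ V1] [_ _ u1]] := in1; split=> //; split=> //.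
by rewrite /upd /= sum1 V1 u1 vt1 vj1 addSn big_nat_recr ?leq_addl.
Qed.

Lemma scan_spec s : ready s -> (nvar s vt <= T I)%N ->
  runs N scan s (fun s' =>
    rvar s' rgap = opt_gapsum I (nvar s vt) (nvar s vm) (T I).+1 /\
    out_S I s' = opt_set I (nvar s vt) (nvar s vm)).
Proof.
set t := nvar s vt; set m := nvar s vm => rd_s le_tT.
apply: runs_seq; apply: runs_run => //; apply: runs_seq; apply: runs_run => //.
pose rec_ := records (T I) (eligible I t m) (weight I t).
(* After [k] iterations the indicator is final exactly on the visited periods, those with
   [T I < i + k]. *)
pose Inv k s' := [/\ ready s', nvar s' vt = t /\ nvar s' vm = m,
  rvar s' rmin = opt_min I t m k, rvar s' rgap = opt_gapsum I t m k
  & forall i, (i <= T I)%N -> (T I < i + k)%N ->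
      (narr s' aS i != 0%N) = rec_ i].
apply: (runs_weaken (Q := Inv (T I).+1)).
  move=> s' [_ _ _ gap' S']; split=> //; apply/setP => i; rewrite !inE.
  by rewrite S' -/rec_ //; have := ltn_ord i; lia.
apply: runs_for => //.
- by move=> k s1 [[[/= -> _ _ _] _ _] _ _ _ _]; rewrite addn1.
- split=> //; first by rewrite /opt_gapsum big_geq.
  by move=> i; lia.
move=> k s1 lt_k vi1 [rd1 [vt1 vm1] min1 gap1 S1].
apply: runs_run => //.
have [[T1 L1 _ _] _ sl1] := rd1.
have le_k : (T I - k <= T I)%N by exact: leq_subr.
have w1 : rarr s1 aslack (T I - k) - rarr s1 aslack t = weight I t (T I - k).
  by rewrite !sl1.
have kE : (T I - (T I - k))%N = k by rewrite subKn.
have minE : opt_min I t m k.+1 =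
    if rec_ (T I - k)%N then weight I t (T I - k) else opt_min I t m k.
  by rewrite /opt_min /rec_ /records kE.
have gapE : opt_gapsum I t m k.+1 = opt_gapsum I t m k +
    if (t - m + 1 <= T I - k)%N then opt_min I t m k.+1 else 0.
  rewrite /opt_gapsum big_mkcond big_nat_recr //= -big_mkcond /=.
  by rewrite addn1.
(* The negated comparison is the strict inequality that defines a record. *)
have testE : [&& (t - m + 1 <= T I - k)%N, (T I - k <= t - 1 - (3 - L I))%N
    & ~~ (rvar s1 rmin <= weight I t (T I - k))] = rec_ (T I - k)%N.
  by rewrite andbA min1 -ltNge /rec_ /records kE.
have SE (s' : state R) b :
    (forall i, narr s' aS i = if i == (T I - k)%N then b else narr s1 aS i) ->
    (b != 0%N) = rec_ (T I - k)%N ->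
    forall i, (i <= T I)%N -> (T I < i + k.+1)%N ->
      (narr s' aS i != 0%N) = rec_ i.
  move=> s'E bE i iT iTk; rewrite s'E; case: (i =P _) => [->//|ne].
  by apply: S1 => //; lia.
rewrite /= T1 L1 vi1 vt1 vm1 w1 testE.
set s2 := if rec_ _ then _ else _.
have [fr2 min2 S2] : [/\ [/\ nvar s2 = nvar s1, rvar s2 rcap = rvar s1 rcap,
      rvar s2 rgap = rvar s1 rgap, rarr s2 = rarr s1 & ready s2],
    rvar s2 rmin = opt_min I t m k.+1
  & forall i, (i <= T I)%N -> (T I < i + k.+1)%N ->
      (narr s2 aS i != 0%N) = rec_ i].
  rewrite minE /s2; case: ifP => rec_k; split=> //;
    [apply: (SE _ 1%N) | apply: (SE _ 0%N)]; rewrite ?rec_k // => i /=;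
    by rewrite /upd /=; case: (i =P _).
have [n2 _ gap2 _ rd2] := fr2.
(* The gap accumulates the minimum already updated at this period, hence [opt_min] at [k.+1]. *)
rewrite n2 T1 vi1 vt1 vm1; case: ifP gapE => _ gapE; rewrite ?addr0 in gapE.
  split; first by rewrite /= n2.
  split=> //=; rewrite ?n2 //.
  by rewrite /upd /= gap2 gap1 min2 gapE.
split; first by rewrite n2.
by split=> //; rewrite ?n2 // gap2 gap1 gapE.
Qed.

Lemma evaluate_spec s : ready s -> (nvar s vt <= T I)%N ->
    rvar s rgap = opt_gapsum I (nvar s vt) (nvar s vm) (T I).+1 ->
    rvar s rsum =
      \sum_(3 <= k < L I) (k - 2)%:R * V I * u I (nvar s vt - k) ->
  runs N evaluate s
    (fun s' => rvar s' rviol = opt_violation I (nvar s vt) (nvar s vm)).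
Proof.
move=> [[T1 L1 [c1 c2 c3 c4] [x1 y1 u1]] _ sl] le_tT gap1 sum1.
apply: runs_run => //; rewrite /=.
set v := (X in set_rvar s rviol X).
have vE : v + phi I (nvar s vt) = opt_violation I (nvar s vt) (nvar s vm).
  rewrite /v L1 c2 c3 c4 x1 y1 !sl ?gap1 ?sum1; try lia.
  by rewrite /opt_violation /base_violation /lhs /beta; ring.
rewrite /upd /= -/v L1 c1 c3 c4 u1.
rewrite -vE /phi /posp; have -> : (L I <= 2)%N = (L I == 2) by lia.
case: eqP => //= _; last by rewrite addr0.
by case: lerP => _ /=; rewrite /upd /= ?mul0r ?addr0.
Qed.

(* (t', m') comes before (t, m) in the lexicographic order of the search. *)
Definition visited (t m t' m' : nat) : bool :=
  (t' < t)%N || (t' == t) && (m' < m)%N.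

(** While nothing is found, [rbest] is 0 and the first clause says that no visited legal pair gives
    a violation. *)
Definition best_so_far (t m : nat) s : Prop :=
  (forall t' m', visited t m t' m' -> legal I t' m' -> (t' <= T I)%N ->
     opt_violation I t' m' <= rvar s rbest) /\
  if nvar s vfound != 0%N then
    [/\ legal I (nvar s vbest_t) (nvar s vbest_m),
        (nvar s vbest_t <= T I)%N, 0 < rvar s rbest
      & rvar s rbest = opt_violation I (nvar s vbest_t) (nvar s vbest_m)]
  else rvar s rbest = 0.

Lemma best_so_far_frame p s s' t m : frame p s s' ->
  all (fun l => l \notin writes p)
    [:: (0, vfound); (0, vbest_t); (0, vbest_m); (2, rbest)]%N ->
  best_so_far t m s -> best_so_far t m s'.
Proof.
by move=> [f0 _ f2 _] /= /and5P[h1 h2 h3 h4 _];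
  rewrite /best_so_far !f0 // f2.
Qed.

Lemma update_spec s t m :
    nvar s vt = t -> nvar s vm = m -> legal I t m -> (t <= T I)%N ->
    rvar s rviol = opt_violation I t m -> best_so_far t m s ->
  runs N update s (best_so_far t m.+1).
Proof.
move=> vt1 vm1 tm tT viol1 [max1 best1]; apply: runs_run => //=.
have le0 : 0 <= rvar s rbest.
  by move: best1; case: ifP => _ => [[_ _ /ltW]|->].
have vis t' m' : visited t m.+1 t' m' ->
    visited t m t' m' \/ t' = t /\ m' = m by rewrite /visited; lia.
rewrite viol1; case: lerP => [le_v|lt_v] /=; split=> //.
- by move=> t' m' /vis[/max1|[-> ->]].
- move=> t' m' /vis[|[-> ->]] /=; rewrite /upd /= ?viol1 //.
  by move=> v' l' T'; apply: le_trans (ltW lt_v); apply: max1.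
- rewrite /= /upd /= vt1 vm1; split=> //.
  exact: le_lt_trans lt_v.
Qed.

Lemma consider_spec s t m :
    nvar s vt = t -> nvar s vm = m -> (t <= T I)%N ->
    ready s -> best_so_far t m s ->
  runs N consider s (best_so_far t m.+1).
Proof.
move=> vt1 vm1 tT rd1 best1.
have [[T1 L1 _ _] cap1 _] := rd1.
apply: runs_if => /=; rewrite L1 vt1 vm1 cap1 => tm; last first.
  (* The only newly visited pair is [(t, m)], which is not legal here. *)
  apply: runs_run => //=; case: best1 => max1 best1; split=> // t' m'.
  have [[-> ->]|ne] : (t' = t /\ m' = m) \/ ~ (t' = t /\ m' = m) by lia.
    by move=> _ tm'; rewrite /legal in tm'; rewrite tm' in tm.
  by move=> vis; apply: max1; move: vis; rewrite /visited; lia.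
apply: runs_seq.
have le1 : (nvar s vt <= T I)%N by rewrite vt1.
apply: runs_weaken (runs_frame (scan_spec rd1 le1)) => s2 [[gap2 _] fr2].
have rd2 := ready_frame fr2 isT rd1.
have [f02 _ _ _] := fr2.
apply: runs_seq.
have [in2 _ _] := rd2.
apply: runs_weaken (runs_frame (compute_ramp_spec in2)) => s3 [sum3 fr3].
have rd3 := ready_frame fr3 isT rd2.
have [f03 _ f23 _] := fr3.
have vt3 : nvar s3 vt = t by rewrite f03 // f02.
have vm3 : nvar s3 vm = m by rewrite f03 // f02.
have gap3 : rvar s3 rgap = opt_gapsum I (nvar s3 vt) (nvar s3 vm) (T I).+1.
  by rewrite f23 // gap2 vt3 vm3 vt1 vm1.
rewrite -f03 // in sum3.
have le3 : (nvar s3 vt <= T I)%N by rewrite vt3.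
apply: runs_seq.
apply: runs_weaken (runs_frame (evaluate_spec rd3 le3 gap3 sum3)).
move=> s4 [viol4 fr4]; have [f04 _ _ _] := fr4.
apply: update_spec; rewrite ?f04 //.
  by rewrite viol4 vt3 vm3.
apply: (best_so_far_frame fr4 isT); apply: (best_so_far_frame fr3 isT).
exact: (best_so_far_frame fr2 isT).
Qed.

Lemma search_spec s : ready s -> nvar s vfound = 0%N -> rvar s rbest = 0 ->
  runs N search s (fun s' => ready s' /\ best_so_far N 0 s').
Proof.
move=> rd_s found_s best_s.
apply: (runs_for (Inv := fun t s' => ready s' /\ best_so_far t 0 s')) => //.
- by move=> k s1 [[[/= -> _ _ _] _ _] _]; rewrite addn1.
- by split=> //; split=> [t' m'|]; rewrite ?found_s // /visited andbF.
move=> t s1 lt_t vt1 [rd1 best1].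
apply: (runs_weaken (Q := fun s' =>
    [/\ nvar s' vt = t, ready s' & best_so_far t N s'])).
  move=> s' [-> rd' [max' best']]; split=> //; split=> //; split=> //.
  (* Legality forces [m' <= t' - L I - 1 < N], so the inner loop has exhausted the row [t]. *)
  move=> t' m' vis tm' tT'; apply: max' => //.
  move: vis; rewrite /visited andbF orbF ltnS leq_eqVlt orbC.
  by case/orP=> [->//|/eqP->]; rewrite eqxx /=; move: tm' => /and4P[]; lia.
apply: (runs_for (Inv := fun m s' =>
    [/\ nvar s' vt = t, ready s' & best_so_far t m s'])) => //.
- by move=> k s2 [_ [[/= -> _ _ _] _ _] _]; rewrite addn1.
move=> m s2 lt_m vm2 [vt2 rd2 best2].
apply: runs_weaken (runs_frame (consider_spec vt2 vm2 lt_t rd2 best2)).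
move=> s3 [best3 fr3]; have [f0 _ _ _] := fr3.
rewrite !f0 //; split=> //; split=> //.
exact: (ready_frame fr3 isT).
Qed.

Lemma separation_spec : runs N separation (init I) (separated I).
Proof.
have in0 : inputs (init I) by [].
apply: runs_seq.
apply: runs_weaken (runs_frame (compute_cap_spec in0)) => s1 [[in1 cap1] fr1].
apply: runs_seq.
apply: runs_weaken (runs_frame (compute_slack_spec in1 cap1)) => s2 [rd2 fr2].
have [f01 _ f21 _] := fr1; have [f02 _ f22 _] := fr2.
have found2 : nvar s2 vfound = 0%N by rewrite f02 // f01.
have best2 : rvar s2 rbest = 0 by rewrite f22 // f21.
apply: runs_seq.
apply: runs_weaken (search_spec rd2 found2 best2) => s3 [rd3 [max3 best3]].
have max_viol t m (S : periods I) : in_family t m S ->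
    violation t m S <= rvar s3 rbest.
  move=> tmS; apply: le_trans (opt_violation_max _ _ tmS) _ => //.
  case/(in_familyE _ _ _ L_ge2): tmS => tm tT _.
  by apply: max3 => //; rewrite /visited ltnS tT.
apply: runs_if => /= found3; last first.
  apply: runs_run => //=; rewrite /separated /out_found.
  move: best3; have -> : nvar s3 2 = 0%N by lia.
  by move=> /= best3 t m S /max_viol; rewrite best3.
move: best3; have -> : nvar s3 2 != 0%N by lia.
case=> tm tT gt0 bestE.
apply: runs_seq; apply: runs_run => //; apply: runs_seq; apply: runs_run => //.
set s4 := run _ _.
have rd4 : ready s4 by [].
apply: runs_weaken (runs_frame (scan_spec rd4 tT)) => s5 [[_ S5] fr5].
have [f0 _ _ _] := fr5.
rewrite /separated /out_found /out_t /out_m !f0 //.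
have -> : nvar s4 2 != 0%N by rewrite /= /upd /=; lia.
rewrite S5.
(* The rescanned set attains the recorded maximum, which by [max_viol] bounds the whole family. *)
have viol4 : violation (nvar s4 vt) (nvar s4 vm)
    (opt_set I (nvar s4 vt) (nvar s4 vm)) = rvar s3 rbest.
  by rewrite violation_opt_set.
split; rewrite ?viol4 //.
exact: opt_set_in_family.
Qed.

End Correctness.

Theorem proposition15 (R : realType) :
  exists (P : cmd) (c : R -> nat), forall I : instance R,
    (2 <= L I)%N -> (L I + 1 <= T I)%N ->
    0 <= Clow I -> Clow I <= Vbar I -> Vbar I <= Cup I -> 0 < V I ->
    (forall k, 0 <= xhat I 0 k) ->
    (forall k, 0 <= yhat I 0 k) ->
    (forall k, 0 <= uhat I 0 k) ->
    exists (n : nat) (s : state R),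
      [/\ exec P (init I) n s,
          (n <= c (mcap I) * T I ^ 3)%N
        & separated I s].
Proof.
(* The loop depth is three (over t, over m, and the scan), every loop makes at most [T I + 1]
   iterations, and [T I + 1 <= 2 * T I] gives the factor [2 ^ 3]. *)
exists separation, (fun=> cost 1 separation * 2 ^ 3)%N.
move=> I L2 LT _ _ _ V0 _ _ _.
have [n [s [ex le_n sep]]] := separation_spec L2 LT V0.
exists n, s; split=> //; apply: leq_trans le_n _.
apply: leq_trans (cost_le _ _) _ => //.
rewrite -mulnA leq_mul2l -expnMn; apply/orP; right.
by rewrite leq_exp2r //; lia.
Qed.
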